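(* Define the elements $X_1=-[J_2,q_0]$, $X_2=[J_1,X_1]$, and $X_k=-[J_2,q_k]$ for $3\le k\le l-1$. Then $$\operatorname{ad}(J_1)q_0=-q_2,\qquad \operatorname{ad}(J_1)q_2=-q_0,$$ $$\operatorname{ad}(X_1)q_1=q_0,\qquad \operatorname{ad}(X_1)q_0=q_1,$$ $$\operatorname{ad}(X_2)q_2=q_1,\qquad \operatorname{ad}(X_2)q_1=-q_2,$$ and, for every $3\le k\le l-1$, $$\operatorname{ad}(X_k)q_k=-q_1,\qquad \operatorname{ad}(X_k)q_1=q_k.$$
   Context: Let $l\ge 3$. Here $SO(p,q)$ denotes the identity component of the special orthogonal group of signature $(p,q)$. Let $G=SO(2,l-1)$ act on $\mathbb R^{2,l-1}$ (two positive and $l-1$ negative directions), let $H=SO(1,l-1)\subset G$ be the stabilizer of a vector of square norm $+1$, let $\mathfrak g,\mathfrak h$ be their Lie algebras and let $B$ be the Killing form of $\mathfrak g$. Let $\sigma$ be the involutive automorphism of $\mathfrak g$ whose $+1$-eigenspace is $\mathfrak h$, and let $\mathfrak q$ be its $-1$-eigenspace. Let $\theta$ be a Cartan involution of $\mathfrak g$ commuting with $\sigma$, with $+1$-eigenspace $\mathfrak k$ and $-1$-eigenspace $\mathfrak p$. Let $\mathfrak a\subset\mathfrak p$ be a maximal abelian subalgebra with a basis $J_1\in\mathfrak h$, $J_2\in\mathfrak q$, normalized so that, writing $\mathfrak g_{(\alpha,\beta)}=\{X\in\mathfrak g:[J_1,X]=\alpha X,\ [J_2,X]=\beta X\}$,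 the restricted roots are $(\pm1,\pm1)$ (four roots, each of multiplicity one) and, if $l\ge4$, $(\pm1,0),(0,\pm1)$ (each of multiplicity $l-3$). Choose $X_{++}\in\mathfrak g_{(1,1)}$ with $[\theta X_{++},X_{++}]=4(J_1+J_2)$, and a basis $X^k_{0+}$ ($3\le k\le l-1$) of $\mathfrak g_{(0,1)}$ with $[\theta X^k_{0+},X^k_{0+}]=2J_2$ and $B(X^j_{0+},\theta X^k_{0+})=0$ for $j\neq k$. Put $q_0=\tfrac14(X_{++}-\sigma X_{++}+\theta X_{++}-\sigma\theta X_{++})$ (the component of $X_{++}$ in $\mathfrak k\cap\mathfrak q$), $q_1=J_2$, $q_2=-[J_1,q_0]$, and $q_k=\tfrac12(X^k_{0+}-\theta X^k_{0+})$ for $3\le k\le l-1$ (the component of $X^k_{0+}$ in $\mathfrak p$). These are elements of $\mathfrak q$. *)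

(* Defs.v *)
From HB Require Import structures.
From mathcomp Require Import all_boot all_order all_algebra.
From mathcomp Require Import reals.

Set Implicit Arguments.
Unset Strict Implicit.
Unset Printing Implicit Defensive.

Import Order.TTheory GRing.Theory Num.Theory.
Local Open Scope ring_scope.

Section MatrixLieAlgebra.
Variables (R : realType) (n : nat).
Implicit Types (X Y : 'M[R]_n) (g a : {vspace 'M[R]_n}) (s : 'M[R]_n -> 'M[R]_n).

Definition ad X Y : 'M[R]_n := X *m Y - Y *m X.

Lemma ad_is_linear X : linear (ad X).
Proof.
move=> c Y Z; rewrite /ad mulmxDr mulmxDl -scalemxAr -scalemxAl scalerBr.
by rewrite opprD addrACA.
Qed.

HB.instance Definition _ X :=
  GRing.isLinear.Build R 'M[R]_n 'M[R]_n _ (ad X) (ad_is_linear X).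

(* The trace of the endomorphism [ad X \o ad Y] of the subspace [g], computed
   in a basis of [g]; this is the Killing form of [g] only when [g] is a
   subalgebra containing [X] and [Y]. *)
Definition killing_form g X Y : R :=
  \sum_(i < \dim g) coord (vbasis g) i (ad X (ad Y (vbasis g)`_i)).

(* Maps of [g] are represented by maps of the ambient matrix space, of which
   only the values on [g] matter. Bijectivity follows from involutivity. *)
Definition involutive_automorphism g s : Prop :=
  [/\ {in g, forall X, s X \in g},
      {in g &, forall X Y, forall c : R, s (c *: X + Y) = c *: s X + s Y},
      {in g &, forall X Y, s (ad X Y) = ad (s X) (s Y)} &
      {in g, forall X, s (s X) = X}].

Definition cartan_involution g s : Prop :=
  involutive_automorphism g s /\
  {in g, forall X, X != 0 -> 0 < - killing_form g X (s X)}.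

Definition eigenspace_in g s (c : R) : {pred 'M[R]_n} :=
  [pred X | (X \in g) && (s X == c *: X)].

Definition abelian_subspace a : Prop := {in a &, forall X Y, ad X Y = 0}.

(* Maximality is among the abelian subalgebras contained in [P]. *)
Definition maximal_abelian_in (P : {pred 'M[R]_n}) a : Prop :=
  [/\ {subset a <= P}, abelian_subspace a &
      forall b : {vspace 'M[R]_n},
        {subset b <= P} -> abelian_subspace b -> (a <= b)%VS -> b = a].

(* A linear form on the span of [J1, J2] is represented by the pair of its
   values at [J1] and [J2]. *)
Definition root_space g J1 J2 (r : R * R) : {vspace 'M[R]_n} :=
  (g :&: passmx.leigenspace (linfun (ad J1)) r.1
     :&: passmx.leigenspace (linfun (ad J2)) r.2)%VS.

Lemma mem_root_space g J1 J2 r X :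
  (X \in root_space g J1 J2 r) =
  [&& X \in g, ad J1 X == r.1 *: X & ad J2 X == r.2 *: X].
Proof.
by rewrite !memv_cap !memv_ker !add_lfunE !opp_lfunE !scale_lfunE !id_lfunE
           !lfunE /= !subr_eq0 andbA.
Qed.

Definition restricted_root g J1 J2 (r : R * R) : Prop :=
  r != (0, 0) /\ root_space g J1 J2 r != 0%VS.

End MatrixLieAlgebra.

Definition long_roots (R : realType) : seq (R * R) :=
  [:: (1, 1); (1, -1); (-1, 1); (-1, -1)].

Definition short_roots (R : realType) : seq (R * R) :=
  [:: (1, 0); (-1, 0); (0, 1); (0, -1)].

Section IndefiniteOrthogonal.
Variables (R : realType) (p q : nat).

Definition form_mx : 'M[R]_(p + q) := block_mx 1%:M 0 0 (- 1%:M).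

Definition square_norm (v : 'cV[R]_(p + q)) : R := (v^T *m form_mx *m v) 0 0.

Definition skew_defect (X : 'M[R]_(p + q)) : 'M[R]_(p + q) :=
  X^T *m form_mx + form_mx *m X.

Lemma skew_defect_is_linear : linear skew_defect.
Proof.
move=> c X Y; rewrite /skew_defect raddfD /= linearZ /= mulmxDl mulmxDr.
by rewrite -scalemxAl -scalemxAr scalerDr addrACA.
Qed.

HB.instance Definition _ :=
  GRing.isLinear.Build R 'M[R]_(p + q) 'M[R]_(p + q) _
    skew_defect skew_defect_is_linear.

(* The Lie algebra of the group of matrices preserving the form, and hence of
   its identity component. *)
Definition so_alg : {vspace 'M[R]_(p + q)} := lker (linfun skew_defect).

Lemma mem_so_alg X :
  (X \in so_alg) = (X^T *m form_mx + form_mx *m X == 0).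
Proof. by rewrite memv_ker lfunE. Qed.

(* The Lie algebra of the stabilizer of [v]. *)
Definition so_stab (v : 'cV[R]_(p + q)) : {vspace 'M[R]_(p + q)} :=
  (so_alg :&: lker (linfun (mulmxr v)))%VS.

Lemma mem_so_stab v X :
  (X \in so_stab v) = (X \in so_alg) && (X *m v == 0).
Proof. by rewrite memv_cap [X in _ && X]memv_ker lfunE. Qed.

End IndefiniteOrthogonal.

(* Main.v *)
(* Under [sigma] and [theta] the four long root spaces are permuted, so that
   [Xpp, sigma Xpp, theta Xpp, sigma (theta Xpp)] have roots
   [(1, 1), (1, -1), (-1, -1), (-1, 1)]. Two of these vectors with non-opposite
   roots commute, as the sum of their roots, [(+-2, 0)] or [(0, +-2)], is not a
   root; the brackets of opposite ones are given by the normalization and its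
   image under [sigma]. All the identities then follow by bilinearity. *)
Require Import Defs.
From HB Require Import structures.
From mathcomp Require Import all_boot all_order all_algebra.
From mathcomp Require Import reals.
From mathcomp Require Import ring.

Set Implicit Arguments.
Unset Strict Implicit.
Unset Printing Implicit Defensive.

Import Order.TTheory GRing.Theory Num.Theory.
Local Open Scope ring_scope.


Section Bracket.
Variables (R : realType) (n : nat).
Implicit Types (X Y Z : 'M[R]_n) (g : {vspace 'M[R]_n}).
Implicit Types (s : 'M[R]_n -> 'M[R]_n).

Lemma adC X Y : ad X Y = - ad Y X.
Proof. by rewrite /ad opprB. Qed.

Lemma ad_self X : ad X X = 0.
Proof. exact: subrr. Qed.

Lemma adDl X Y Z : ad (X + Y) Z = ad X Z + ad Y Z.
Proof. by rewrite /ad mulmxDl mulmxDr opprD addrACA. Qed.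

Lemma adNl X Y : ad (- X) Y = - ad X Y.
Proof. by rewrite /ad mulNmx mulmxN opprB opprK addrC. Qed.

Lemma adZl (c : R) X Y : ad (c *: X) Y = c *: ad X Y.
Proof. by rewrite /ad -scalemxAl -scalemxAr scalerBr. Qed.

Lemma adDr X Y Z : ad X (Y + Z) = ad X Y + ad X Z.
Proof. exact: linearD. Qed.

Lemma adNr X Y : ad X (- Y) = - ad X Y.
Proof. exact: linearN. Qed.

Lemma adZr (c : R) X Y : ad X (c *: Y) = c *: ad X Y.
Proof. exact: linearZ. Qed.

Definition ad_bilinE := (adDl, adNl, adZl, adDr, adNr, adZr).

Lemma ad_jacobi X Y Z : ad X (ad Y Z) = ad (ad X Y) Z + ad Y (ad X Z).
Proof.
rewrite /ad !mulmxBr !mulmxBl !mulmxA.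
by apply/matrixP=> i j; rewrite !mxE; ring.
Qed.

(** By the Jacobi identity [ad J1] and [ad J2] are derivations, so eigenvalues add under the
    bracket. Closure of [g] is a hypothesis because [g] is only a subspace here. *)
Lemma mem_root_space_ad g J1 J2 (a1 a2 b1 b2 : R) X Y :
    {in g &, forall U V, ad U V \in g} ->
    X \in root_space g J1 J2 (a1, a2) -> Y \in root_space g J1 J2 (b1, b2) ->
  ad X Y \in root_space g J1 J2 (a1 + b1, a2 + b2).
Proof.
move=> g_ad; rewrite !mem_root_space /=.
case/and3P=> gX /eqP X1 /eqP X2 /and3P[gY /eqP Y1 /eqP Y2].
by rewrite g_ad // !(ad_jacobi _ X) X1 X2 Y1 Y2 !ad_bilinE /= -!scalerDl !eqxx.
Qed.

(** Since [s] is linear only on [g], the generic linearity lemmas do not apply. The value [s 0 = 0]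
    comes from [s (1 *: 0 + 0) = s 0 + s 0]. *)
Lemma involutive_automorphismZ g s (c : R) X :
  involutive_automorphism g s -> X \in g -> s (c *: X) = c *: s X.
Proof.
case=> _ s_lin _ _ gX.
have s0 : s 0 = 0.
  have := s_lin 0 0 (mem0v g) (mem0v g) 1.
  by rewrite !scale1r addr0 -[LHS]addr0 => /addrI.
by rewrite -[c *: X]addr0 s_lin ?mem0v // s0 addr0.
Qed.

(** As [e * e = 1], one has [J = e *: s J], hence [ad J (s X) = e *: s (ad J X)]. The signs
    [(e1, e2)] will be [(1, -1)] for [sigma] and [(-1, -1)] for [theta]. *)
Lemma mem_root_space_involutive g s J1 J2 (e1 e2 r1 r2 : R) X :
    involutive_automorphism g s -> J1 \in g -> J2 \in g ->
    s J1 = e1 *: J1 -> s J2 = e2 *: J2 -> e1 * e1 = 1 -> e2 * e2 = 1 ->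
    X \in root_space g J1 J2 (r1, r2) ->
  s X \in root_space g J1 J2 (e1 * r1, e2 * r2).
Proof.
move=> s_inv gJ1 gJ2 sJ1 sJ2 e1K e2K; rewrite !mem_root_space /=.
case/and3P=> gX /eqP X1 /eqP X2; have [s_g _ s_ad _] := s_inv.
have adE J e r : J \in g -> s J = e *: J -> e * e = 1 -> ad J X = r *: X ->
    ad J (s X) = (e * r) *: s X.
  move=> gJ sJ eK adJ; rewrite -[J in LHS]scale1r -eK -scalerA -sJ adZl.
  by rewrite -s_ad // adJ (involutive_automorphismZ _ s_inv) // scalerA.
by rewrite s_g // (adE J1 e1 r1) // (adE J2 e2 r2) // !eqxx.
Qed.

Lemma restricted_root_mem g J1 J2 (r : R * R) X :
  r != (0, 0) -> X \in root_space g J1 J2 r -> X != 0 ->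
  restricted_root g J1 J2 r.
Proof.
move=> r_neq0 Xr X_neq0; split=> //.
by apply: contraNneq X_neq0 => r0; rewrite -memv0 -r0.
Qed.

End Bracket.

(** Membership means that moving [form_mx] across [X^T] turns it into [- X]; doing this twice in
    each product of the commutator reverses the factors. *)
Lemma so_alg_ad (R : realType) (p q : nat) :
  {in so_alg R p q &, forall X Y, ad X Y \in so_alg R p q}.
Proof.
move=> X Y; rewrite !mem_so_alg !addr_eq0 => /eqP XF /eqP YF.
rewrite /ad linearB /= !trmx_mul mulmxBl mulmxBr -!mulmxA XF YF.
by rewrite !mulmxN !mulmxA XF YF !mulNmx !opprK opprB.
Qed.

Theorem proposition32 (R : realType) (l : nat) (hl : (3 <= l)%N)
  (v : 'cV[R]_(2 + (l - 1))) (hv : square_norm v = 1)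
  (g h : {vspace 'M[R]_(2 + (l - 1))})
  (hg : g = so_alg R 2 (l - 1)) (hh : h = so_stab v)
  (sigma theta : 'M[R]_(2 + (l - 1)) -> 'M[R]_(2 + (l - 1)))
  (hsigma : involutive_automorphism g sigma)
  (hsigma_h : eigenspace_in g sigma 1 =i h)
  (htheta : cartan_involution g theta)
  (hcomm : {in g, forall X, sigma (theta X) = theta (sigma X)})
  (a : {vspace 'M[R]_(2 + (l - 1))})
  (ha : maximal_abelian_in (eigenspace_in g theta (-1)) a)
  (J1 J2 : 'M[R]_(2 + (l - 1)))
  (hJ : basis_of a [:: J1; J2])
  (hJ1 : J1 \in h) (hJ2 : J2 \in eigenspace_in g sigma (-1))
  (hroots : forall r : R * R, restricted_root g J1 J2 r <->
     r \in long_roots R \/ (4 <= l)%N /\ r \in short_roots R)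
  (hlong : {in long_roots R, forall r, \dim (root_space g J1 J2 r) = 1%N})
  (hshort : (4 <= l)%N ->
     {in short_roots R, forall r, \dim (root_space g J1 J2 r) = (l - 3)%N})
  (Xpp : 'M[R]_(2 + (l - 1)))
  (hXpp : Xpp \in root_space g J1 J2 (1, 1))
  (hXpp_norm : ad (theta Xpp) Xpp = 4 *: (J1 + J2))
  (X0p : nat -> 'M[R]_(2 + (l - 1)))
  (hX0p : basis_of (root_space g J1 J2 (0, 1))
            [seq X0p k | k <- index_iota 3 l])
  (hX0p_norm : forall k : nat, (3 <= k <= l - 1)%N ->
     ad (theta (X0p k)) (X0p k) = 2 *: J2)
  (hX0p_orth : forall j k : nat,
     (3 <= j <= l - 1)%N -> (3 <= k <= l - 1)%N -> j != k ->
     killing_form g (X0p j) (theta (X0p k)) = 0) :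
  let q0 := 4^-1 *: (Xpp - sigma Xpp + theta Xpp - sigma (theta Xpp)) in
  let q1 := J2 in
  let q2 := - ad J1 q0 in
  let q_ k := 2^-1 *: (X0p k - theta (X0p k)) in
  let X1 := - ad J2 q0 in
  let X2 := ad J1 X1 in
  let X_ k := - ad J2 (q_ k) in
  [/\ ad J1 q0 = - q2 /\ ad J1 q2 = - q0,
      ad X1 q1 = q0 /\ ad X1 q0 = q1,
      ad X2 q2 = q1 /\ ad X2 q1 = - q2 &
      forall k : nat, (3 <= k <= l - 1)%N ->
        ad (X_ k) (q_ k) = - q1 /\ ad (X_ k) q1 = q_ k].
Proof.
have g_ad : {in g &, forall X Y, ad X Y \in g} by rewrite hg; exact: so_alg_ad.
case: htheta => theta_inv _.
have [s_g s_lin s_ad sK] := hsigma; have [t_g _ t_ad tK] := theta_inv.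
have /andP[gJ1 /eqP sJ1] : J1 \in eigenspace_in g sigma 1 by rewrite hsigma_h.
have /andP[gJ2 /eqP sJ2] := hJ2.
have theta_a J : J \in [:: J1; J2] -> theta J = -1 *: J.
  case: ha => a_p _ _ Ja.
  by have /a_p/andP[_ /eqP] := basis_mem hJ Ja.
have tJ1 : theta J1 = -1 *: J1 by apply: theta_a; rewrite !inE eqxx.
have tJ2 : theta J2 = -1 *: J2 by apply: theta_a; rewrite !inE eqxx orbT.
have N1K : -1 * -1 = 1 :> R by rewrite mulrNN mulr1.
have sigma_root r1 r2 X : X \in root_space g J1 J2 (r1, r2) ->
    sigma X \in root_space g J1 J2 (r1, - r2).
  move/(mem_root_space_involutive hsigma gJ1 gJ2 sJ1 sJ2 (mulr1 1) N1K).
  by rewrite mul1r mulN1r.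
have theta_root r1 r2 X : X \in root_space g J1 J2 (r1, r2) ->
    theta X \in root_space g J1 J2 (- r1, - r2).
  move/(mem_root_space_involutive theta_inv gJ1 gJ2 tJ1 tJ2 N1K N1K).
  by rewrite !mulN1r.
(* A nonzero bracket would make the sum of the two roots a restricted root, but every coordinate of
   a restricted root has absolute value at most 1. *)
have ad0 a1 a2 b1 b2 X Y :
    X \in root_space g J1 J2 (a1, a2) -> Y \in root_space g J1 J2 (b1, b2) ->
    (`|a1 + b1| == 2) || (`|a2 + b2| == 2) -> ad X Y = 0.
  move=> Xa Yb ab2; have [//|XY_neq0] := eqVneq (ad X Y) 0; exfalso.
  have small r : (r \in long_roots R \/ (4 <= l)%N /\ r \in short_roots R) ->
      `|r.1| <= 1 /\ `|r.2| <= 1.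
    rewrite !inE => -[|[_]] /or4P[] /eqP-> /=;
      by rewrite ?normrN ?normr1 ?normr0 ?lexx ?ler01.
  have XYab := mem_root_space_ad g_ad Xa Yb.
  have ab_neq0 : (a1 + b1, a2 + b2) != (0, 0).
    apply: contraTneq ab2 => -[-> ->].
    by rewrite normr0 orbb eq_sym pnatr_eq0.
  have /hroots/small[/= le1 le2] := restricted_root_mem ab_neq0 XYab XY_neq0.
  case/orP: ab2 => /eqP ab2; [move: le1 | move: le2];
    by rewrite ab2 leNgt ltr1n.
have Ar := hXpp; have Br := sigma_root _ _ _ Ar; have Cr := theta_root _ _ _ Ar.
have Dr := sigma_root _ _ _ Cr; rewrite opprK in Dr.
have CA : ad (theta Xpp) Xpp = 4 *: (J1 + J2) := hXpp_norm.
have gX r X : X \in root_space g J1 J2 r -> X \in g.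
  by rewrite mem_root_space => /and3P[].
(* This is the image of the normalization under [sigma], which fixes [J1] and negates [J2]. *)
have DB : ad (sigma (theta Xpp)) (sigma Xpp) = 4 *: (J1 - J2).
  rewrite -s_ad ?(gX _ _ Ar) ?(gX _ _ Cr) // CA.
  rewrite (involutive_automorphismZ _ hsigma) ?memvD //.
  by rewrite -[J1 in LHS]scale1r s_lin // sJ1 sJ2 scaleN1r !scale1r.
(* The involutions are now forgotten: what remains is [Xpp], [B], [C], [D] with roots [(1, 1)],
   [(1, -1)], [(-1, -1)], [(-1, 1)] and the two brackets of opposite root vectors. *)
move: Ar Br Cr Dr CA DB.
move: (sigma Xpp) (theta Xpp) (sigma (theta Xpp)) => B C D Ar Br Cr Dr CA DB.
have norm2 : `|1 + 1| = 2 :> R by rewrite -[1 + 1]/2 normr_nat.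
have normN2 : `|-1 - 1| = 2 :> R by rewrite -opprD normrN.
have AB : ad Xpp B = 0 by apply: (ad0 _ _ _ _ _ _ Ar Br); rewrite norm2 eqxx.
have AD : ad Xpp D = 0.
  by apply: (ad0 _ _ _ _ _ _ Ar Dr); rewrite norm2 eqxx orbT.
have CB : ad C B = 0.
  by apply: (ad0 _ _ _ _ _ _ Cr Br); rewrite normN2 eqxx orbT.
have CD : ad C D = 0 by apply: (ad0 _ _ _ _ _ _ Cr Dr); rewrite normN2 eqxx.
have rootE r X : X \in root_space g J1 J2 r ->
    [/\ ad J1 X = r.1 *: X, ad J2 X = r.2 *: X & ad X J2 = - (r.2 *: X)].
  by rewrite mem_root_space (adC X) => /and3P[_ /eqP-> /eqP->].
have [/= A1 A2 A2r] := rootE _ _ Ar; have [/= B1 B2 B2r] := rootE _ _ Br.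
have [/= C1 C2 C2r] := rootE _ _ Cr; have [/= D1 D2 D2r] := rootE _ _ Dr.
have J1E := (A1, B1, C1, D1); have J2E := (A2, B2, C2, D2).
have J2rE := (A2r, B2r, C2r, D2r).
(* The reversed brackets are oriented by instances of [adC] at fixed arguments, because repeated
   rewriting with the general law would loop. *)
have orthoE := (AB, AD, CB, CD, (adC B Xpp), (adC D Xpp), (adC B C), (adC D C)).
have oppE := (CA, DB, (adC Xpp C), (adC B D)).
set q0 := 4^-1 *: (_ - _ + _ - _); set q2 := - ad J1 q0.
set X1 := - ad J2 q0; set X2 := ad J1 X1.
(* [ad J1] negates the terms in [C] and [D], and [ad J2] those in [B] and [C]. This determines all
   the sign patterns below. *)
have J1q0 : ad J1 q0 = 4^-1 *: (Xpp - B - C + D).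
  rewrite /q0 !(ad_bilinE, J1E).
  by apply/matrixP=> i j; rewrite !mxE; field.
have J1q2 : ad J1 q2 = - q0.
  rewrite /q2 J1q0 /q0 !(ad_bilinE, J1E).
  by apply/matrixP=> i j; rewrite !mxE; field.
have X1E : X1 = - 4^-1 *: (Xpp + B - C - D).
  rewrite /X1 /q0 !(ad_bilinE, J2E).
  by apply/matrixP=> i j; rewrite !mxE; field.
have X2E : X2 = - 4^-1 *: (Xpp + B + C + D).
  rewrite /X2 X1E !(ad_bilinE, J1E).
  by apply/matrixP=> i j; rewrite !mxE; field.
split; [split | split | split | move=> k k_bnd].
- by rewrite /q2 opprK.
- exact: J1q2.
- rewrite X1E /q0 !(ad_bilinE, J2rE).
  by apply/matrixP=> i j; rewrite !mxE; field.
(* The surviving terms are [-2 *: ad C Xpp + 2 *: ad D B = -16 *: J2]: the [J1] parts cancel, and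
   the prefactor [-1/16] gives [J2]. *)
- rewrite X1E /q0 !(ad_bilinE, ad_self, orthoE, oppE).
  by apply/matrixP=> i j; rewrite !mxE; field.
(* Here the two signs in [q2] and [X2] cancel, and [2 *: ad C Xpp - 2 *: ad D B = 16 *: J2]. *)
- rewrite X2E /q2 J1q0 !(ad_bilinE, ad_self, orthoE, oppE).
  by apply/matrixP=> i j; rewrite !mxE; field.
- rewrite X2E /q2 J1q0 !(ad_bilinE, J2rE).
  by apply/matrixP=> i j; rewrite !mxE; field.
(* [index_iota 3 l] excludes [l], so its range is exactly [3 <= k <= l - 1]. *)
have k_seq : X0p k \in [seq X0p i | i <- index_iota 3 l].
  by apply: map_f; rewrite mem_index_iota -(ltn_predK hl) ltnS -subn1.
have Zr := basis_mem hX0p k_seq; have Tr := theta_root _ _ _ Zr.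
have TZ := hX0p_norm k k_bnd.
have [/= _ Z2 Z2r] := rootE _ _ Zr; have [/= _ T2 T2r] := rootE _ _ Tr.
have X_E : - ad J2 (2^-1 *: (X0p k - theta (X0p k))) =
    - 2^-1 *: (X0p k + theta (X0p k)).
  rewrite !(ad_bilinE, Z2, T2).
  by apply/matrixP=> i j; rewrite !mxE; field.
rewrite X_E; split.
(* With [Z] for [X0p k] and [T] for its image under [theta], [ad (Z + T) (Z - T) = 2 *: ad T Z = 4
   *: J2], and the prefactor is [-1/4]. *)
- rewrite !(ad_bilinE, ad_self, (adC (X0p k) (theta (X0p k))), TZ).
  by apply/matrixP=> i j; rewrite !mxE; field.
- rewrite !(ad_bilinE, Z2r, T2r).
  by apply/matrixP=> i j; rewrite !mxE; field.
Qed.
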